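(* Let $a,b,\mu,\nu\geq1$ be real numbers such that $b\geq\tau(a)$, where $$\tau(a)=\frac{3(a+1)-a^2+\sqrt{a^4+14a^3+35a^2+30a+9}}{2a(a+1)}.$$ Then $\mathbb{W}_{(\mu,a),(\nu,b)}(z)\in\mathcal{S}_p$ (as a function of $z\in\mathbb{D}$).
   Context: $\mathbb{D}=\{z\in\mathbb{C}:|z|<1\}$. The normalized four parameters Wright function is $$\mathbb{W}_{(\mu,a),(\nu,b)}(z)=\sum_{k=0}^{\infty}\frac{\Gamma(a)\Gamma(b)}{\Gamma(a+k\mu)\Gamma(b+k\nu)}\,z^{k+1}.$$ $UCV$ is the class of uniformly convex functions: analytic functions $F$ on $\mathbb{D}$ with $F(0)=0$, $F'(0)=1$ such that for every circular arc $\gamma$ contained in $\mathbb{D}$ with center $\zeta\in\mathbb{D}$, the image arc $F(\gamma)$ is convex. The class $\mathcal{S}_p$ is defined by $\mathcal{S}_p=\{f: f(z)=zF'(z),\ F\in UCV\}$. *)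

(* Defs.v *)
From Stdlib Require Import Reals.
From Coquelicot Require Import Coquelicot.

Open Scope R_scope.

Definition unit_disc (z : C) : Prop := Cmod z < 1.

(* Euler's integral, which represents the Gamma function for x > 0. *)
Definition Gamma (x : R) : R :=
  RInt_gen (fun t : R => Rpower t (x - 1) * exp (- t))
           (at_right 0) (Rbar_locally p_infty).

Definition wright_coef (mu a nu b : R) (k : nat) : R :=
  Gamma a * Gamma b / (Gamma (a + INR k * mu) * Gamma (b + INR k * nu)).

(* [iota] selects the unique sum; Coquelicot's [Series] covers only real terms. *)
Definition wright (mu a nu b : R) (z : C) : C :=
  iota (T := C_CompleteNormedModule) (fun s : C =>
    is_series (K := C_AbsRing) (V := C_NormedModule)
      (fun k : nat => (RtoC (wright_coef mu a nu b k) * Cpow z (k + 1))%C) s).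

Definition holomorphic_on (D : C -> Prop) (F : C -> C) : Prop :=
  forall z : C, D z -> ex_derive (K := C_AbsRing) (V := C_NormedModule) F z.

(* Convexity of an arc in the sense of Goodman: the arc is regular and the
   argument theta of its tangent vector, chosen continuously, is nondecreasing
   as the arc is traversed.  The arc is the restriction of w to [t1, t2]; two-sided
   derivatives at the endpoints presuppose that w extends smoothly beyond them. *)
Definition convex_arc (w : R -> C) (t1 t2 : R) : Prop :=
  exists (w' : R -> C) (theta : R -> R),
    (forall t : R, t1 <= t <= t2 ->
       is_derive (K := R_AbsRing) (V := C_R_NormedModule) w t (w' t) /\
       w' t <> RtoC 0 /\
       w' t = (RtoC (Cmod (w' t)) * (cos (theta t), sin (theta t)))%C /\
       continuous theta t) /\
    (forall s t : R, t1 <= s -> s <= t -> t <= t2 -> theta s <= theta t).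

Definition circle_param (zeta : C) (r t : R) : C :=
  (zeta + RtoC r * (cos t, sin t))%C.

(* Circular arcs are traversed counterclockwise; the bound t2 <= t1 + 2 PI
   admits every arc up to and including the full circle. *)
Definition UCV (F : C -> C) : Prop :=
  holomorphic_on unit_disc F /\
  F (RtoC 0) = RtoC 0 /\
  C_derive F (RtoC 0) = RtoC 1 /\
  forall (zeta : C) (r t1 t2 : R),
    unit_disc zeta -> 0 < r -> t1 < t2 -> t2 <= t1 + 2 * PI ->
    (forall t : R, t1 <= t <= t2 -> unit_disc (circle_param zeta r t)) ->
    convex_arc (fun t : R => F (circle_param zeta r t)) t1 t2.

(* Only the values of f on the unit disc matter. *)
Definition class_Sp (f : C -> C) : Prop :=
  exists F : C -> C,
    UCV F /\ forall z : C, unit_disc z -> f z = (z * C_derive F z)%C.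

Definition tau (a : R) : R :=
  (3 * (a + 1) - a ^ 2
     + sqrt (a ^ 4 + 14 * a ^ 3 + 35 * a ^ 2 + 30 * a + 9))
  / (2 * a * (a + 1)).

(* Main.v *)
(** Let c_k be the Taylor coefficients of W(z)/z and F(z) = sum c_k z^(k+1)/(k+1), so that
    W = z F'.  For every arc of center zeta, the tangent argument of its image under F is
    t + pi/2 + arg F'(z(t)), with derivative 1 + Re((z - zeta) F''/F').  Since
    |z - zeta| < 2, convexity follows from |F''| <= |F'|/2, hence from
    sum_{k>=1} (2k+1) c_k <= 1, a bound that also gives Re F' > 0.

    As Gamma increases on [2, oo), c_k is largest for mu = nu = 1, where
    c_k = 1/((a)_k (b)_k).  Comparing the terms k >= 2 with a geometric series
    reduces the bound to the quadratic inequality in b expressed by b >= tau(a). *)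

Require Import Defs.
From Stdlib Require Import Reals.
From Coquelicot Require Import Coquelicot.
From Stdlib Require Import Lra Lia.
Open Scope R_scope.

(** * The Gamma function on [1, oo) *)

(** Positivity of Re F' gives the tangent argument a closed form: arg F' is an arctangent on the
    right half-plane, so no continuous branch has to be lifted along an arc.

    Gamma has its minimum between 1 and 2, which is why monotonicity starts at 2. For k >= 1 the
    arguments a + k and a + k mu are at least 2; for k = 0 there is nothing to compare.

    The geometric comparison has to start at k = 2. Started at k = 1 with ratio 5/(3P), where P =
    (a+1)(b+1), it already fails at a = 1, b = tau(1). With Q = (a+2)(b+2) and T = 1/(1 - 7/(5Q)) it
    asks for 5T <= (ab - 3)P, whereas b >= tau(a) supplies 2a + 3 <= (ab - 3)(P - 1). At a = 1 the
    numbers 2a + 3 and 5 coincide, and what remains is T <= P/(P - 1), that is 7P <= 5Q. *)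

Lemma is_derive_nondecreasing (f df : R -> R) (a b : R) :
  a <= b ->
  (forall x, a <= x <= b -> is_derive f x (df x)) ->
  (forall x, a <= x <= b -> 0 <= df x) ->
  f a <= f b.
Proof.
  intros Hab Hd Hpos.
  destruct (MVT_gen f a b df) as [c [Hc Heq]].
  - intros x Hx. rewrite Rmin_left, Rmax_right in Hx by lra. apply Hd; lra.
  - intros x Hx. rewrite Rmin_left, Rmax_right in Hx by lra.
    apply continuity_pt_filterlim, (ex_derive_continuous f x).
    exists (df x). apply Hd; lra.
  - rewrite Rmin_left, Rmax_right in Hc by lra.
    pose proof (Hpos c Hc).
    nra.
Qed.

(** Cauchy criterion: the oscillation of [Phi] is controlled by that of [Psi]. Applied to
    primitives, it says that an improper integral converges once a primitive of a majorant has a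
    limit; [D] is the range on which the majorant is valid. *)
Lemma filterlim_dominated_increments (F : (R -> Prop) -> Prop) (FF : ProperFilter F)
    (D : R -> Prop) (Phi Psi : R -> R) (l : R) :
  F D ->
  (forall u v, D u -> D v -> u <= v -> Rabs (Phi v - Phi u) <= Psi v - Psi u) ->
  filterlim Psi F (locally l) ->
  exists l', filterlim Phi F (locally l').
Proof.
  intros HD Hdom Hlim.
  apply (filterlim_locally_cauchy (F := F) (U := R_CompleteSpace) Phi).
  intros eps.
  pose proof (proj2 (filterlim_locally_cauchy (F := F) (U := R_CompleteSpace) Psi)
                (ex_intro _ l Hlim)) as Hc.
  destruct (Hc eps) as [P [HP Hball]].
  exists (fun t => P t /\ D t). split; [now apply filter_and|].
  intros u v [Pu Du] [Pv Dv].
  specialize (Hball u v Pu Pv).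
  change (Rabs (Psi v - Psi u) < eps) in Hball.
  change (Rabs (Phi v - Phi u) < eps).
  destruct (Rle_dec u v) as [Huv|Huv].
  - specialize (Hdom u v Du Dv Huv).
    pose proof (Rle_abs (Psi v - Psi u)). lra.
  - specialize (Hdom v u Dv Du ltac:(lra)).
    rewrite Rabs_minus_sym. rewrite Rabs_minus_sym in Hball.
    pose proof (Rle_abs (Psi u - Psi v)). lra.
Qed.

(** Reduces an integral that is improper at both ends to two independent limits of one primitive. It
    yields the convergence of [Gamma], its value at 1 and its functional equation. *)
Lemma is_RInt_gen_primitive (f Phi : R -> R) (la lb : R) :
  (forall t, 0 < t -> is_derive Phi t (f t)) ->
  (forall t, 0 < t -> continuous f t) ->
  filterlim Phi (at_right 0) (locally la) ->
  filterlim Phi (Rbar_locally p_infty) (locally lb) ->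
  is_RInt_gen f (at_right 0) (Rbar_locally p_infty) (lb - la).
Proof.
  intros Hd Hc Ha Hb P HP.
  assert (Hl : filterlim (fun ab : R * R => Phi (snd ab) - Phi (fst ab))
            (filter_prod (at_right 0) (Rbar_locally p_infty)) (locally (lb - la))).
  { apply (filterlim_comp_2 (G := locally lb) (H := locally (opp la))
             (fun ab : R * R => Phi (snd ab)) (fun ab : R * R => opp (Phi (fst ab))) Rplus).
    - apply (filterlim_comp _ _ _ snd Phi _ (Rbar_locally p_infty)); [apply filterlim_snd|exact Hb].
    - apply (filterlim_comp _ _ _ (fun ab : R * R => Phi (fst ab)) opp _ (locally la)).
      + apply (filterlim_comp _ _ _ fst Phi _ (at_right 0)); [apply filterlim_fst|exact Ha].
      + apply (filterlim_opp (V := R_NormedModule)).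
    - apply (filterlim_plus (V := R_NormedModule)). }
  specialize (Hl P HP). unfold filtermap in Hl. unfold filtermapi.
  assert (Hpos : filter_prod (at_right 0) (Rbar_locally p_infty)
            (fun ab : R * R => 0 < fst ab /\ 0 < snd ab)).
  { exists (fun u => 0 < u) (fun v => 0 < v).
    - exists (mkposreal 1 Rlt_0_1). intros y _ Hy; exact Hy.
    - exists 0. intros; assumption.
    - intros; simpl; split; assumption. }
  generalize (filter_and _ _ Hl Hpos). apply filter_imp.
  intros [u v] [HPuv [Hu Hv]]; simpl in *.
  exists (Phi v - Phi u). split; [|exact HPuv].
  assert (Hm : forall t, Rmin u v <= t -> 0 < t).
  { intros t Ht. unfold Rmin in Ht. destruct (Rle_dec u v); lra. }
  apply (is_RInt_derive (V := R_CompleteNormedModule) Phi f).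
  - intros t Ht. apply Hd, Hm, Ht.
  - intros t Ht. apply Hc, Hm, Ht.
Qed.

Definition gamma_integrand (x t : R) : R := Rpower t (x - 1) * exp (- t).

Lemma gamma_integrand_pos (x t : R) : 0 < gamma_integrand x t.
Proof. apply Rmult_lt_0_compat; apply exp_pos. Qed.

Lemma gamma_integrand_continuous (x t : R) : 0 < t -> continuous (gamma_integrand x) t.
Proof.
  intros Ht. apply (ex_derive_continuous (gamma_integrand x)).
  unfold gamma_integrand, Rpower. auto_derive. exact Ht.
Qed.

Lemma gamma_integrand_succ (x t : R) :
  0 < t -> gamma_integrand (x + 1) t = t * gamma_integrand x t.
Proof.
  intros Ht. unfold gamma_integrand.
  replace (x + 1 - 1) with (1 + (x - 1)) by ring.
  rewrite Rpower_plus, Rpower_1 by exact Ht. ring.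
Qed.

Lemma gamma_integrand_le_1 (x t : R) : 1 <= x -> 0 < t <= 1 -> gamma_integrand x t <= 1.
Proof.
  intros Hx Ht. unfold gamma_integrand, Rpower.
  rewrite <- exp_plus.
  assert (ln t <= 0) by (rewrite <- ln_1; apply ln_le; lra).
  assert (Hneg : (x - 1) * ln t + - t < 0) by nra.
  apply exp_increasing in Hneg. rewrite exp_0 in Hneg. lra.
Qed.

Lemma ln_le_sub_1 (t : R) : 0 < t -> ln t <= t - 1.
Proof.
  intros Ht. pose proof (exp_ineq1_le (ln t)). rewrite exp_ln in H by exact Ht. lra.
Qed.

(** The concave [ln] lies below its tangent at [s = 2 * x]. The slope 1/(2x) makes the linear part
    of (x - 1) ln t at most t/2, which leaves half of the exponential decay. *)
Lemma gamma_integrand_exp_bound (x : R) :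
  1 <= x -> exists K, 0 < K /\ forall t, 0 < t -> gamma_integrand x t <= K * exp (- (t / 2)).
Proof.
  intros Hx. set (s := 2 * x).
  exists (exp ((x - 1) * ln s)). split; [apply exp_pos|].
  intros t Ht. unfold gamma_integrand, Rpower. rewrite <- !exp_plus.
  assert (Hs : 0 < s) by (unfold s; lra).
  assert (Hl : ln t <= t / s - 1 + ln s).
  { pose proof (ln_le_sub_1 (t / s) ltac:(now apply Rdiv_lt_0_compat)) as H.
    rewrite ln_div in H by assumption. lra. }
  assert (Hts : (x - 1) * (t / s) <= t / 2).
  { unfold s. apply Rmult_le_reg_r with (2 * x); [lra|]. field_simplify; nra. }
  assert (Hle : (x - 1) * ln t + - t <= (x - 1) * ln s + - (t / 2)) by nra.
  destruct Hle as [Hle|Hle]; [now apply Rlt_le, exp_increasing|rewrite Hle; lra].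
Qed.

Lemma filterlim_exp_neg_half :
  filterlim (fun t => exp (- (t / 2))) (Rbar_locally p_infty) (locally 0).
Proof.
  apply filterlim_locally. intros eps.
  exists (2 / eps). intros t Ht.
  assert (He : 0 < eps) by apply cond_pos.
  change (Rabs (exp (- (t / 2)) - 0) < eps).
  rewrite Rminus_0_r, Rabs_pos_eq by apply Rlt_le, exp_pos.
  rewrite exp_Ropp.
  assert (0 < t / 2) by (assert (0 < 2 / eps) by (apply Rdiv_lt_0_compat; lra); lra).
  assert (H1 : / eps < exp (t / 2)).
  { apply Rlt_trans with (t / 2); [unfold Rdiv in *; lra|].
    pose proof (exp_ineq1_le (t / 2)); lra. }
  rewrite <- (Rinv_inv eps).
  apply Rinv_lt_contravar; [|exact H1].
  apply Rmult_lt_0_compat; [now apply Rinv_0_lt_compat|apply exp_pos].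
Qed.

(** [RInt_gen] denotes a number even for a divergent integral, so convergence precedes every
    property of [Gamma]. The primitive based at 1 has increments dominated near 0 by those of t, the
    integrand being at most 1 there, and near infinity by those of a multiple of -exp(-t/2). *)
Lemma Gamma_correct (x : R) :
  1 <= x ->
  is_RInt_gen (gamma_integrand x) (at_right 0) (Rbar_locally p_infty) (Gamma x).
Proof.
  intros Hx. apply (RInt_gen_correct (V := R_CompleteNormedModule)).
  set (Phi := fun t => RInt (gamma_integrand x) 1 t).
  assert (HPhi : forall t, 0 < t -> is_derive Phi t (gamma_integrand x t)).
  { intros t Ht. apply (is_derive_RInt (V := R_NormedModule) _ _ 1).
    - exists (mkposreal t Ht). intros y Hy.
      apply (RInt_correct (V := R_CompleteNormedModule)).
      apply (ex_RInt_continuous (V := R_CompleteNormedModule)).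
      intros z Hz. apply gamma_integrand_continuous.
      change (Rabs (y - t) < t) in Hy. apply Rabs_def2 in Hy.
      unfold Rmin in Hz. destruct (Rle_dec 1 y); lra.
    - now apply gamma_integrand_continuous. }
  assert (Hinc : forall (Psi psi : R -> R) (u v : R), 0 < u <= v ->
            (forall t, u <= t <= v -> is_derive Psi t (psi t)) ->
            (forall t, u <= t <= v -> gamma_integrand x t <= psi t) ->
            Rabs (Phi v - Phi u) <= Psi v - Psi u).
  { intros Psi psi u v Huv HPsi Hle. apply Rabs_le. split.
    - assert (Phi u <= Phi v); [|assert (Psi u <= Psi v); [|lra]].
      + apply is_derive_nondecreasing with (gamma_integrand x); [lra| |].
        * intros t Ht. apply HPhi; lra.
        * intros t Ht. apply Rlt_le, gamma_integrand_pos.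
      + apply is_derive_nondecreasing with psi; [lra|assumption|].
        intros t Ht. pose proof (gamma_integrand_pos x t). specialize (Hle t Ht). lra.
    - assert (Psi u - Phi u <= Psi v - Phi v); [|lra].
      apply (is_derive_nondecreasing (fun t => Psi t - Phi t)
               (fun t => psi t - gamma_integrand x t)); [lra| |].
      + intros t Ht. apply (is_derive_minus (V := R_NormedModule)); [now apply HPsi|apply HPhi; lra].
      + intros t Ht. specialize (Hle t Ht). lra. }
  destruct (filterlim_dominated_increments (at_right 0) _ (fun t => 0 < t <= 1)
              Phi (fun t => t) 0) as [la Hla].
  { exists (mkposreal 1 Rlt_0_1). intros y Hy Hy0. change (Rabs (y - 0) < 1) in Hy.
    apply Rabs_def2 in Hy. lra. }
  { intros u v Hu Hv Huv. apply (Hinc (fun t => t) (fun _ => 1)); [lra| |].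
    - intros t Ht. auto_derive; [exact I|reflexivity].
    - intros t Ht. apply gamma_integrand_le_1; lra. }
  { intros P [e He]. exists e. intros y Hy _. apply He, Hy. }
  destruct (gamma_integrand_exp_bound x Hx) as [K [HK HKb]].
  destruct (filterlim_dominated_increments (Rbar_locally p_infty) _ (fun t => 0 < t)
              Phi (fun t => - (2 * K) * exp (- (t / 2))) (- (2 * K) * 0)) as [lb Hlb].
  { exists 0. intros; assumption. }
  { intros u v Hu Hv Huv.
    apply (Hinc (fun t => - (2 * K) * exp (- (t / 2))) (fun t => K * exp (- (t / 2)))); [lra| |].
    - intros t Ht. auto_derive; [exact I|]. unfold Rdiv. field.
    - intros t Ht. apply HKb; lra. }
  { apply (filterlim_comp _ _ _ (fun t => exp (- (t / 2))) (fun y => - (2 * K) * y) _ (locally 0)).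
    - apply filterlim_exp_neg_half.
    - apply (filterlim_scal_r (V := R_NormedModule) (- (2 * K)) 0). }
  exists (lb - la).
  apply (is_RInt_gen_primitive _ Phi); try assumption.
  intros t Ht. now apply gamma_integrand_continuous.
Qed.

Lemma is_RInt_gen_nonneg (f : R -> R) (l : R) :
  (forall t, 0 < t -> 0 <= f t) ->
  is_RInt_gen f (at_right 0) (Rbar_locally p_infty) l -> 0 <= l.
Proof.
  intros Hf Hl.
  (* The norm inequality for integrals, applied to the zero function written as [scal 0 (f t)] and
     dominated by [f], reads 0 <= l. *)
  assert (Hle : norm (scal 0 l) <= l).
  { apply (RInt_gen_norm (V := R_CompleteNormedModule)
             (Fa := at_right 0) (Fb := Rbar_locally p_infty)
             (fun t => scal 0 (f t)) f).
    - exists (fun u => u < 1) (fun v => 1 < v).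
      + exists (mkposreal 1 Rlt_0_1). intros y Hy _. change (Rabs (y - 0) < 1) in Hy.
        apply Rabs_def2 in Hy; lra.
      + exists 1. intros; assumption.
      + intros; simpl; lra.
    - exists (fun u => 0 < u) (fun v => True).
      + exists (mkposreal 1 Rlt_0_1). intros y _ Hy; exact Hy.
      + exists 0; trivial.
      + intros u v Hu _ t Ht; simpl in Ht.
        change (Rabs (0 * f t) <= f t). rewrite Rmult_0_l, Rabs_R0. apply Hf; lra.
    - apply (is_RInt_gen_scal (V := R_NormedModule)), Hl.
    - exact Hl. }
  change (Rabs (0 * l) <= l) in Hle. rewrite Rmult_0_l, Rabs_R0 in Hle. exact Hle.
Qed.

Lemma is_RInt_gen_ext_pos (f g : R -> R) (l : R) :
  (forall t, 0 < t -> f t = g t) ->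
  is_RInt_gen f (at_right 0) (Rbar_locally p_infty) l ->
  is_RInt_gen g (at_right 0) (Rbar_locally p_infty) l.
Proof.
  intros Hfg. apply (is_RInt_gen_ext (V := R_NormedModule)).
  exists (fun u => 0 < u) (fun v => 0 < v).
  - exists (mkposreal 1 Rlt_0_1). intros y _ Hy; exact Hy.
  - exists 0; intros; assumption.
  - intros u v Hu Hv t Ht; simpl in Ht. apply Hfg.
    unfold Rmin in Ht. destruct (Rle_dec u v); lra.
Qed.

Lemma is_RInt_gen_pos_unique (f : R -> R) (l l' : R) :
  is_RInt_gen f (at_right 0) (Rbar_locally p_infty) l ->
  is_RInt_gen f (at_right 0) (Rbar_locally p_infty) l' -> l = l'.
Proof.
  intros H H'.
  rewrite <- (is_RInt_gen_unique (V := R_CompleteNormedModule) f l H).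
  apply (is_RInt_gen_unique (V := R_CompleteNormedModule)), H'.
Qed.

Lemma continuous_filterlim_at_right (f : R -> R) (x l : R) :
  continuous f x -> f x = l -> filterlim f (at_right x) (locally l).
Proof.
  intros Hf <-. apply filterlim_filter_le_1 with (2 := Hf).
  intros P [e He]. exists e. intros y Hy _. now apply He.
Qed.

Lemma filterlim_exp_dominated (f : R -> R) (K : R) :
  (forall t, 0 < t -> 0 <= f t <= K * exp (- (t / 2))) ->
  filterlim f (Rbar_locally p_infty) (locally 0).
Proof.
  intros Hf.
  assert (HK : filterlim (fun t => K * exp (- (t / 2))) (Rbar_locally p_infty) (locally (K * 0))).
  { apply (filterlim_comp _ _ _ (fun t => exp (- (t / 2))) (fun y => K * y) _ (locally 0)).
    - apply filterlim_exp_neg_half.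
    - apply (filterlim_scal_r (V := R_NormedModule) K 0). }
  rewrite Rmult_0_r in HK.
  apply (filterlim_le_le (fun _ => 0) f (fun t => K * exp (- (t / 2))) 0).
  - exists 0. intros t Ht. now apply Hf.
  - apply filterlim_const.
  - exact HK.
Qed.

Lemma Gamma_1 : Gamma 1 = 1.
Proof.
  apply (is_RInt_gen_pos_unique (gamma_integrand 1)); [apply Gamma_correct; lra|].
  replace 1 with (- 0 - (- 1)) at 2 by ring.
  apply is_RInt_gen_ext_pos with (fun t => exp (- t)).
  { intros t Ht. unfold gamma_integrand.
    replace (1 - 1) with 0 by ring. rewrite Rpower_O by exact Ht. ring. }
  assert (Hd : forall t, is_derive (fun t => - exp (- t)) t (exp (- t))).
  { intros t. auto_derive; [exact I|]. ring. }
  apply (is_RInt_gen_primitive _ (fun t => - exp (- t))).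
  - intros t _. apply Hd.
  - intros t _. apply (ex_derive_continuous (fun t => exp (- t))). auto_derive. exact I.
  - apply continuous_filterlim_at_right.
    + apply (ex_derive_continuous (fun t => - exp (- t))). exists (exp (- 0)). apply Hd.
    + rewrite Ropp_0, exp_0. reflexivity.
  - apply (filterlim_comp _ _ _ (fun t => exp (- t)) Ropp _ (locally 0)).
    + apply filterlim_exp_dominated with 1. intros t Ht. rewrite Rmult_1_l.
      split; apply Rlt_le; [apply exp_pos|apply exp_increasing; lra].
    + apply (filterlim_opp (V := R_NormedModule)).
Qed.

(** Integration by parts: t^x exp(-t), which is [gamma_integrand (x + 1)], has the difference of the
    two integrands as its derivative and vanishes at both ends. Near 0 it is squeezed below t. *)
Lemma Gamma_succ (x : R) : 1 <= x -> Gamma (x + 1) = x * Gamma x.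
Proof.
  intros Hx.
  assert (H : is_RInt_gen (fun t => x * gamma_integrand x t - gamma_integrand (x + 1) t)
                (at_right 0) (Rbar_locally p_infty) (0 - 0)).
  { apply (is_RInt_gen_primitive _ (gamma_integrand (x + 1))).
    - intros t Ht. unfold gamma_integrand, Rpower. auto_derive; [exact Ht|].
      replace (x + 1 + - (1)) with (1 + (x - 1)) by ring.
      replace (x + 1 - 1) with (1 + (x - 1)) by ring.
      rewrite (Rmult_plus_distr_r 1 (x - 1) (ln t)), exp_plus, (Rmult_1_l (ln t)), exp_ln by exact Ht.
      field. lra.
    - intros t Ht.
      apply (continuous_minus (V := R_NormedModule) (fun t => x * gamma_integrand x t)).
      + apply (continuous_scal_r (V := R_NormedModule) x (gamma_integrand x)).
        now apply gamma_integrand_continuous.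
      + now apply gamma_integrand_continuous.
    - apply (filterlim_le_le (fun _ => 0) (gamma_integrand (x + 1)) (fun t => t) 0).
      + exists (mkposreal 1 Rlt_0_1). intros t Ht1 Ht.
        change (Rabs (t - 0) < 1) in Ht1. apply Rabs_def2 in Ht1.
        split; [apply Rlt_le, gamma_integrand_pos|].
        rewrite gamma_integrand_succ by exact Ht.
        pose proof (gamma_integrand_le_1 x t Hx ltac:(lra)). nra.
      + apply filterlim_const.
      + intros P [e He]. exists e. intros y Hy _. apply He, Hy.
    - destruct (gamma_integrand_exp_bound (x + 1) ltac:(lra)) as [K [_ HK]].
      apply filterlim_exp_dominated with K. intros t Ht.
      split; [apply Rlt_le, gamma_integrand_pos|now apply HK]. }
  pose proof (is_RInt_gen_minus (V := R_NormedModule) _ _ _ _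
    (is_RInt_gen_scal (V := R_NormedModule) _ x _ (Gamma_correct x Hx))
    (Gamma_correct (x + 1) ltac:(lra))) as H'.
  pose proof (is_RInt_gen_pos_unique _ _ _ H H') as Heq.
  change (0 - 0 = x * Gamma x - Gamma (x + 1)) in Heq. lra.
Qed.

(* The integrand estimate is t^(y-x) - 1 >= (y-x) ln t >= (y-x) (1 - 1/t). *)
Lemma Gamma_increment (x y : R) :
  2 <= x <= y -> (y - x) * ((x - 2) * Gamma (x - 1)) <= Gamma y - Gamma x.
Proof.
  intros Hxy.
  assert (Hy1 : 1 <= y) by lra. assert (Hx1 : 1 <= x) by lra.
  assert (Hx2 : 1 <= x - 1) by lra.
  pose proof (is_RInt_gen_minus (V := R_NormedModule) _ _ _ _
    (is_RInt_gen_minus (V := R_NormedModule) _ _ _ _ (Gamma_correct y Hy1) (Gamma_correct x Hx1))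
    (is_RInt_gen_scal (V := R_NormedModule) _ (y - x) _
      (is_RInt_gen_minus (V := R_NormedModule) _ _ _ _
        (Gamma_correct x Hx1) (Gamma_correct (x - 1) Hx2)))) as H.
  apply is_RInt_gen_nonneg in H.
  - change (0 <= (Gamma y - Gamma x) - (y - x) * (Gamma x - Gamma (x - 1))) in H.
    pose proof (Gamma_succ (x - 1) Hx2) as Hs.
    replace (x - 1 + 1) with x in Hs by ring. rewrite Hs in H at 2. nra.
  - intros t Ht.
    change (0 <= (gamma_integrand y t - gamma_integrand x t)
                 - (y - x) * (gamma_integrand x t - gamma_integrand (x - 1) t)).
    assert (Hy : gamma_integrand y t = exp ((y - x) * ln t) * gamma_integrand x t).
    { unfold gamma_integrand, Rpower. rewrite <- !exp_plus. f_equal. ring. }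
    assert (Hx : gamma_integrand (x - 1) t = / t * gamma_integrand x t).
    { pose proof (gamma_integrand_succ (x - 1) t Ht) as Hs.
      replace (x - 1 + 1) with x in Hs by ring. rewrite Hs. field. lra. }
    rewrite Hx, Hy.
    pose proof (gamma_integrand_pos x t).
    pose proof (exp_ineq1_le ((y - x) * ln t)).
    pose proof (ln_le_sub_1 (/ t) ltac:(now apply Rinv_0_lt_compat)) as Hl.
    rewrite ln_Rinv in Hl by exact Ht.
    assert (0 <= (y - x) * (ln t - (1 - / t))) by (apply Rmult_le_pos; lra).
    assert (0 <= exp ((y - x) * ln t) - 1 - (y - x) * (1 - / t)) by lra.
    nra.
Qed.

(** At the endpoint 2 the lower bound of [Gamma_increment] carries the factor 2 - 2 = 0, so it gives
    x Gamma(x) = Gamma(x + 1) >= Gamma(2) = 1. Strict positivity thus comes without a strict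
    inequality between integrals. *)
Lemma Gamma_pos (x : R) : 1 <= x -> 0 < Gamma x.
Proof.
  intros Hx.
  pose proof (Gamma_increment 2 (x + 1) ltac:(lra)) as H.
  assert (H2 : Gamma 2 = 1).
  { replace 2 with (1 + 1) by ring. rewrite Gamma_succ, Gamma_1; lra. }
  rewrite H2, Gamma_succ in H by lra. nra.
Qed.

Lemma Gamma_nondecreasing (x y : R) : 2 <= x <= y -> Gamma x <= Gamma y.
Proof.
  intros Hxy. pose proof (Gamma_increment x y Hxy).
  pose proof (Gamma_pos (x - 1) ltac:(lra)).
  assert (0 <= (y - x) * ((x - 2) * Gamma (x - 1))).
  { apply Rmult_le_pos; [lra|]. apply Rmult_le_pos; lra. }
  lra.
Qed.

(** * Coefficient bounds *)

Lemma wright_coef_0 (mu a nu b : R) : 1 <= a -> 1 <= b -> wright_coef mu a nu b 0 = 1.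
Proof.
  intros Ha Hb. unfold wright_coef. simpl INR. rewrite !Rmult_0_l, !Rplus_0_r.
  pose proof (Gamma_pos a Ha). pose proof (Gamma_pos b Hb). field. lra.
Qed.

Lemma wright_coef_bounds (mu a nu b : R) (k : nat) :
  1 <= a -> 1 <= b -> 1 <= mu -> 1 <= nu ->
  0 < wright_coef mu a nu b k <= wright_coef 1 a 1 b k.
Proof.
  intros Ha Hb Hmu Hnu.
  pose proof (pos_INR k) as Hk.
  assert (Hge : forall c la, 1 <= c -> 1 <= la ->
            0 < Gamma (c + INR k * 1) <= Gamma (c + INR k * la)).
  { intros c la Hc Hla. split; [apply Gamma_pos; lra|].
    (* For index 0 both arguments equal [c], possibly below 2; for a successor they are at least
       2. *)
    destruct k as [|k]; [simpl INR; rewrite !Rmult_0_l; lra|].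
    rewrite S_INR in *. pose proof (pos_INR k).
    apply Gamma_nondecreasing. nra. }
  pose proof (Hge a mu Ha Hmu). pose proof (Hge b nu Hb Hnu).
  pose proof (Gamma_pos a Ha). pose proof (Gamma_pos b Hb).
  unfold wright_coef. split.
  - apply Rdiv_lt_0_compat; apply Rmult_lt_0_compat; lra.
  - apply Rmult_le_compat_l; [nra|].
    apply Rinv_le_contravar; [apply Rmult_lt_0_compat; lra|].
    apply Rmult_le_compat; lra.
Qed.

Lemma wright_coef_succ (a b : R) (k : nat) :
  1 <= a -> 1 <= b ->
  wright_coef 1 a 1 b (S k) = wright_coef 1 a 1 b k / ((a + INR k) * (b + INR k)).
Proof.
  intros Ha Hb. unfold wright_coef. rewrite S_INR. pose proof (pos_INR k).
  replace (a + (INR k + 1) * 1) with (a + INR k * 1 + 1) by ring.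
  replace (b + (INR k + 1) * 1) with (b + INR k * 1 + 1) by ring.
  rewrite !Gamma_succ by lra.
  pose proof (Gamma_pos (a + INR k * 1) ltac:(lra)).
  pose proof (Gamma_pos (b + INR k * 1) ltac:(lra)).
  field. repeat split; lra.
Qed.

(* tau a is the positive root of a(a+1) b^2 - (3(a+1) - a^2) b - (5a+3), which equals
   (ab - 3)((a+1)(b+1) - 1) - (2a+3). *)
Lemma tau_quadratic (a b : R) :
  1 <= a -> tau a <= b -> 2 * a + 3 <= (a * b - 3) * ((a + 1) * (b + 1) - 1).
Proof.
  intros Ha Hb. unfold tau in Hb.
  set (p := 3 * (a + 1) - a ^ 2) in *.
  set (d := a ^ 4 + 14 * a ^ 3 + 35 * a ^ 2 + 30 * a + 9) in *.
  assert (Hd : 0 <= d) by (unfold d; nra).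
  pose proof (sqrt_pos d) as Hs. pose proof (sqrt_sqrt d Hd) as Hss.
  apply Rmult_le_compat_r with (r := 2 * a * (a + 1)) in Hb; [|nra].
  unfold Rdiv in Hb. rewrite Rmult_assoc, Rinv_l, Rmult_1_r in Hb by nra.
  (* Here d = p^2 + 4a(a+1)(5a+3) is the discriminant, so squaring returns the quadratic in b
     multiplied by 4a(a+1). *)
  assert (Hsq : d <= (b * (2 * a * (a + 1)) - p) * (b * (2 * a * (a + 1)) - p)).
  { rewrite <- Hss. apply Rmult_le_compat; lra. }
  unfold d, p in Hsq.
  assert (0 <= (4 * a * (a + 1)) *
     ((a * b - 3) * ((a + 1) * (b + 1) - 1) - (2 * a + 3))); nra.
Qed.

(* From the second term on, t shrinks by a factor of at most 7/(5Q) at each step;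
   T is the sum 1/(1 - 7/(5Q)) of the corresponding geometric series. *)
Lemma wright_coef_sum_bound (a b : R) (N : nat) :
  1 <= a -> 1 <= b -> tau a <= b ->
  sum_n (fun k => (2 * INR (S k) + 1) * wright_coef 1 a 1 b (S k)) N <= 1.
Proof.
  intros Ha Hb Htau.
  set (t := fun k => (2 * INR (S k) + 1) * wright_coef 1 a 1 b (S k)).
  set (Q := (a + 2) * (b + 2)).
  set (T := 5 * Q / (5 * Q - 7)).
  assert (HQ : 9 <= Q) by (unfold Q; nra).
  assert (Hstep : forall k, (2 * INR (S k) + 1) * (a + INR (S k)) * (b + INR (S k)) * t (S k)
                            = (2 * INR (S k) + 3) * t k).
  { intros k. unfold t. rewrite (wright_coef_succ a b (S k)) by assumption.
    pose proof (pos_INR (S k)). rewrite (S_INR (S k)). field. lra. }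
  assert (Ht : forall k, 0 < t k).
  { intros k. apply Rmult_lt_0_compat; [pose proof (pos_INR (S k)); lra|].
    apply wright_coef_bounds; lra. }
  (* The quotient (2r+3)/(2r+1) decreases in r and equals 7/5 at r = 2, where (a+r)(b+r) is
     smallest, namely Q. *)
  assert (Hratio : forall k, 5 * Q * t (S (S k)) <= 7 * t (S k)).
  { intros k. pose proof (Hstep (S k)) as Hk.
    set (r := INR (S (S k))) in *.
    assert (Hr : 2 <= r) by (unfold r; rewrite !S_INR; pose proof (pos_INR k); lra).
    assert (Q <= (a + r) * (b + r)) by (unfold Q; apply Rmult_le_compat; lra).
    pose proof (Ht (S k)). pose proof (Ht (S (S k))).
    assert ((2 * r + 1) * (Q * t (S (S k))) <= (2 * r + 3) * t (S k)).
    { rewrite <- Hk. rewrite !Rmult_assoc. apply Rmult_le_compat_l; [lra|].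
      rewrite <- !Rmult_assoc. apply Rmult_le_compat_r; lra. }
    assert (5 * (2 * r + 3) * t (S k) <= 7 * (2 * r + 1) * t (S k)).
    { apply Rmult_le_compat_r; lra. }
    apply Rmult_le_reg_l with (2 * r + 1); lra. }
  assert (HT : T * (5 * Q - 7) = 5 * Q) by (unfold T; field; lra).
  assert (HT0 : 1 <= T) by nra.
  (* Adding the geometric estimate of the tail makes the left side nonincreasing in n, because
     7T/(5Q) = T - 1. Only the case n = 0 depends on [tau]. *)
  assert (Hinv : forall n, sum_n t n + T * t (S n) <= 1).
  { induction n as [|n IH].
    - rewrite sum_O.
      pose proof (Hstep 0%nat) as H1. pose proof (tau_quadratic a b Ha Htau) as Hq.
      simpl INR in H1.
      assert (H0 : t 0%nat * (a * b) = 3).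
      { unfold t. rewrite wright_coef_succ, wright_coef_0 by assumption.
        simpl INR. field. lra. }
      set (P := (a + 1) * (b + 1)) in *.
      assert (HP : 4 <= P) by (unfold P; nra).
      assert (HPQ : 25 * (P - 1) * Q <= (2 * a + 3) * (P * (5 * Q - 7))).
      { assert (76 * (a - 1) * P <= 2 * (a - 1) * (5 * Q - 7) * P).
        { apply Rmult_le_compat_r; [lra|]. nra. }
        assert (35 * P <= 25 * Q + 76 * (a - 1) * P) 
          by (unfold P, Q; assert (0 <= (a - 1) * (b + 1)) by nra;
              assert (0 <= (a - 1) * ((a - 1) * (b + 1))) by nra; nra).
        lra. }
      (* Since t 0 = 3/(ab) and t 1 = 5 t 0/(3P), this is t 0 + T t 1 <= 1 cleared of
         denominators. *)
      assert (HTP : 5 * T <= (a * b - 3) * P).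
      { apply Rmult_le_reg_r with ((P - 1) * (5 * Q - 7)); [nra|].
        replace (5 * T * ((P - 1) * (5 * Q - 7))) with (5 * (P - 1) * (T * (5 * Q - 7))) by ring.
        rewrite HT.
        replace ((a * b - 3) * P * ((P - 1) * (5 * Q - 7)))
          with ((a * b - 3) * (P - 1) * (P * (5 * Q - 7))) by ring.
        assert ((2 * a + 3) * (P * (5 * Q - 7)) <= (a * b - 3) * (P - 1) * (P * (5 * Q - 7))).
        { apply Rmult_le_compat_r; nra. }
        lra. }
      pose proof (Ht 0%nat).
      assert (H1' : 3 * P * t 1%nat = 5 * t 0%nat) by (unfold P; lra).
      apply Rmult_le_reg_l with (3 * P); [lra|].
      replace (3 * P * (t 0%nat + T * t 1%nat))
        with (3 * P * t 0%nat + T * (3 * P * t 1%nat)) by ring.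
      rewrite H1'.
      assert (5 * T * t 0%nat <= (a * b - 3) * P * t 0%nat) by (apply Rmult_le_compat_r; lra).
      replace (3 * P * 1) with (P * (t 0%nat * (a * b))) by (rewrite H0; ring).
      lra.
    - rewrite sum_Sn. change (sum_n t n + t (S n) + T * t (S (S n)) <= 1).
      pose proof (Hratio n). pose proof (Ht (S n)). pose proof (Ht (S (S n))).
      assert (T * t (S (S n)) <= (T - 1) * t (S n)); [|lra].
      apply Rmult_le_reg_l with (5 * Q); [lra|].
      assert (T * (5 * Q * t (S (S n))) <= T * (7 * t (S n))) by (apply Rmult_le_compat_l; lra).
      replace (5 * Q * ((T - 1) * t (S n))) with (T * (7 * t (S n))); [lra|].
      transitivity ((T * (5 * Q) - T * (5 * Q - 7)) * t (S n)); [ring|rewrite HT; ring]. }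
  pose proof (Hinv N). pose proof (Ht (S N)). fold t. nra.
Qed.

(** * Complex power series *)

Lemma is_series_Cmod_le (u : nat -> C) (b : nat -> R) (s : C) :
  is_series (K := C_AbsRing) (V := C_NormedModule) u s ->
  (forall n, Cmod (u n) <= b n) -> ex_series b ->
  Cmod s <= Series b.
Proof.
  intros Hu Hb Hex.
  assert (Hpart : forall n, Cmod (sum_n (G := C_AbelianMonoid) u n) <= sum_n b n).
  { induction n as [|n IH].
    - rewrite !sum_O. apply Hb.
    - rewrite !sum_Sn. eapply Rle_trans; [apply Cmod_triangle|].
      apply Rplus_le_compat; [exact IH|apply Hb]. }
  apply (is_lim_seq_le (fun n => Cmod (sum_n (G := C_AbelianMonoid) u n)) (sum_n b)
           (Finite (Cmod s)) (Finite (Series b)) Hpart).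
  - apply (filterlim_comp _ _ _ _ _ _ _ _ Hu (filterlim_norm (V := C_NormedModule) s)).
  - apply Series_correct, Hex.
Qed.

Definition cterm (a : nat -> R) (z : C) (k : nat) : C := (RtoC (a k) * Cpow z k)%C.

Definition cpseries (a : nat -> R) (z : C) : C :=
  iota (T := C_CompleteNormedModule) (fun s : C =>
    is_series (K := C_AbsRing) (V := C_NormedModule) (cterm a z) s).

Lemma Cmod_pow_le_1 (z : C) (n : nat) : Cmod z <= 1 -> Cmod (Cpow z n) <= 1.
Proof.
  intros Hz. rewrite Cmod_pow. pose proof (Cmod_ge_0 z).
  rewrite <- (pow1 n). apply pow_incr. lra.
Qed.

Lemma Cmod_cterm_le (a : nat -> R) (z : C) (k : nat) :
  Cmod z <= 1 -> Cmod (cterm a z k) <= Rabs (a k).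
Proof.
  intros Hz. unfold cterm. rewrite Cmod_mult, Cmod_R.
  pose proof (Cmod_pow_le_1 z k Hz). pose proof (Rabs_pos (a k)). nra.
Qed.

Lemma iota_is_series_C (u : nat -> C) (s : C) :
  is_series (K := C_AbsRing) (V := C_NormedModule) u s ->
  iota (T := C_CompleteNormedModule)
    (fun s : C => is_series (K := C_AbsRing) (V := C_NormedModule) u s) = s.
Proof.
  intros Hs. apply (iota_filterlim_locally (V := C_CompleteNormedModule)), Hs.
Qed.

Lemma cpseries_correct (a : nat -> R) (z : C) :
  ex_series (fun n => Rabs (a n)) -> Cmod z <= 1 ->
  is_series (K := C_AbsRing) (V := C_NormedModule) (cterm a z) (cpseries a z).
Proof.
  intros Ha Hz.
  destruct (ex_series_le (V := C_CompleteNormedModule) (cterm a z) _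
              (fun n => Cmod_cterm_le a z n Hz) Ha) as [s Hs].
  unfold cpseries. rewrite (iota_is_series_C _ s); exact Hs.
Qed.

Definition cpseries_deriv (a : nat -> R) (k : nat) : R := INR (S k) * a (S k).

(** The remainders satisfy E(n+1) = w E(n) + (n+1) z^n (w - z)^2. On the closed disc the constant
    therefore grows by at most m = n + 1, and m^2 + m <= (m + 1)^2. *)
Lemma Cpow_taylor_remainder (w z : C) (n : nat) :
  Cmod w <= 1 -> Cmod z <= 1 ->
  Cmod (w ^ S n - z ^ S n - RtoC (INR (S n)) * z ^ n * (w - z))%C
    <= (INR (S n)) ^ 2 * Cmod (w - z) ^ 2.
Proof.
  intros Hw Hz. induction n as [|n IH].
  - replace (w ^ 1 - z ^ 1 - RtoC (INR 1) * z ^ 0 * (w - z))%C with (RtoC 0)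
      by (simpl; ring).
    rewrite Cmod_0. pose proof (pow2_ge_0 (INR 1)). pose proof (pow2_ge_0 (Cmod (w - z))).
    apply Rmult_le_pos; assumption.
  - set (E := (w ^ S n - z ^ S n - RtoC (INR (S n)) * z ^ n * (w - z))%C) in *.
    replace (w ^ S (S n) - z ^ S (S n) - RtoC (INR (S (S n))) * z ^ S n * (w - z))%C
      with (w * E + RtoC (INR (S n)) * z ^ n * ((w - z) * (w - z)))%C.
    2: { unfold E. rewrite (S_INR (S n)), RtoC_plus. rewrite !Cpow_S. ring. }
    eapply Rle_trans; [apply Cmod_triangle|].
    rewrite !Cmod_mult, Cmod_R.
    pose proof (Cmod_pow_le_1 z n Hz).
    pose proof (Cmod_ge_0 E). pose proof (Cmod_ge_0 (w - z)). pose proof (Cmod_ge_0 (z ^ n)).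
    pose proof (pos_INR n).
    rewrite (S_INR (S n)). rewrite Rabs_pos_eq by (rewrite S_INR; lra).
    set (d := Cmod (w - z)) in *. set (m := INR (S n)) in *.
    assert (Hm : 0 <= m) by apply pos_INR.
    assert (Cmod w * Cmod E <= m ^ 2 * d ^ 2) by nra.
    assert (m * Cmod (z ^ n) * (d * d) <= m * (d * d)).
    { apply Rmult_le_compat_r; nra. }
    nra.
Qed.

Lemma ex_series_cpseries_deriv (a : nat -> R) :
  ex_series (fun n => (INR n + 1) ^ 2 * Rabs (a n)) ->
  ex_series (fun n => Rabs (cpseries_deriv a n)).
Proof.
  intros H. apply (ex_series_incr_1 (V := R_NormedModule)) in H.
  apply (ex_series_le (V := R_CompleteNormedModule)) with (2 := H).
  intros n. change (Rabs (Rabs (cpseries_deriv a n)) <= (INR (S n) + 1) ^ 2 * Rabs (a (S n))).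
  rewrite Rabs_Rabsolu. unfold cpseries_deriv.
  rewrite Rabs_mult, (Rabs_pos_eq (INR (S n))) by apply pos_INR.
  apply Rmult_le_compat_r; [apply Rabs_pos|]. pose proof (pos_INR (S n)). nra.
Qed.

Lemma ex_series_abs_weight (a : nat -> R) :
  ex_series (fun n => (INR n + 1) ^ 2 * Rabs (a n)) -> ex_series (fun n => Rabs (a n)).
Proof.
  intros H. apply (ex_series_le (V := R_CompleteNormedModule)) with (2 := H).
  intros n. change (Rabs (Rabs (a n)) <= (INR n + 1) ^ 2 * Rabs (a n)).
  rewrite Rabs_Rabsolu. pose proof (pos_INR n). pose proof (Rabs_pos (a n)). nra.
Qed.

(** Summing the remainders of the powers gives a quadratic error with one constant for the whole
    closed disc. Termwise differentiation follows directly, without a theorem on uniform limits of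
    derivatives. *)
Lemma cpseries_taylor_remainder (a : nat -> R) (w z : C) :
  ex_series (fun n => (INR n + 1) ^ 2 * Rabs (a n)) ->
  Cmod w <= 1 -> Cmod z <= 1 ->
  Cmod (cpseries a w - cpseries a z - (w - z) * cpseries (cpseries_deriv a) z)%C
    <= Series (fun n => (INR n + 1) ^ 2 * Rabs (a n)) * Cmod (w - z) ^ 2.
Proof.
  intros Ha Hw Hz.
  pose proof (ex_series_abs_weight a Ha) as Habs.
  (* The derived series is shifted by one place, with 0 in front, so that its terms line up with
     those of the two other series. *)
  set (D := fun n => match n with O => RtoC 0 | S k => cterm (cpseries_deriv a) z k end).
  assert (HD : is_series (K := C_AbsRing) (V := C_NormedModule) D
                 (cpseries (cpseries_deriv a) z)).
  { apply (is_series_decr_1 (V := C_NormedModule)).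
    match goal with |- is_series _ ?s => assert (HD0 : s = cpseries (cpseries_deriv a) z) end.
    { change (cpseries (cpseries_deriv a) z - RtoC 0 = cpseries (cpseries_deriv a) z)%C. ring. }
    rewrite HD0. apply cpseries_correct; [|exact Hz].
    now apply ex_series_cpseries_deriv. }
  pose proof (is_series_minus (V := C_NormedModule) _ _ _ _
    (is_series_minus (V := C_NormedModule) _ _ _ _
      (cpseries_correct a w Habs Hw) (cpseries_correct a z Habs Hz))
    (is_series_scal (V := C_NormedModule) (w - z)%C _ _ HD)) as Hs.
  rewrite Rmult_comm, <- Series_scal_l.
  refine (is_series_Cmod_le _ (fun n => Cmod (w - z) ^ 2 * ((INR n + 1) ^ 2 * Rabs (a n))) _ Hs _ _).
  2: { apply (ex_series_scal (V := R_NormedModule) (Cmod (w - z) ^ 2)), Ha. }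
  intros n.
  change (Cmod (cterm a w n - cterm a z n - (w - z) * D n)%C
          <= Cmod (w - z) ^ 2 * ((INR n + 1) ^ 2 * Rabs (a n))).
  pose proof (Rabs_pos (a n)) as Hp. pose proof (pow2_ge_0 (Cmod (w - z))) as Hd.
  destruct n as [|n].
  - replace (cterm a w 0 - cterm a z 0 - (w - z) * D 0%nat)%C with (RtoC 0)
      by (unfold cterm, D; simpl; ring).
    rewrite Cmod_0. simpl INR. nra.
  - replace (cterm a w (S n) - cterm a z (S n) - (w - z) * D (S n))%C
      with (RtoC (a (S n)) *
            (w ^ S n - z ^ S n - RtoC (INR (S n)) * z ^ n * (w - z)))%C
      by (unfold cterm, D, cterm, cpseries_deriv; rewrite RtoC_mult; ring).
    rewrite Cmod_mult, Cmod_R.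
    pose proof (Cpow_taylor_remainder w z n Hw Hz) as Ht.
    pose proof (pos_INR (S n)) as Hn.
    set (m := INR (S n)) in *. set (d := Cmod (w - z) ^ 2) in *.
    assert (m ^ 2 * d <= d * (m + 1) ^ 2) by nra.
    apply Rle_trans with (Rabs (a (S n)) * (d * (m + 1) ^ 2)); [|lra].
    apply Rmult_le_compat_l; lra.
Qed.

Lemma cpseries_derive (a : nat -> R) (z : C) :
  ex_series (fun n => (INR n + 1) ^ 2 * Rabs (a n)) -> Cmod z < 1 ->
  is_derive (K := C_AbsRing) (V := C_NormedModule) (cpseries a) z
    (cpseries (cpseries_deriv a) z).
Proof.
  intros Ha Hz. split.
  { apply (is_linear_scal_l (V := C_NormedModule)). }
  intros x Hx.
  apply (is_filter_lim_locally_unique (V := AbsRing_NormedModule C_AbsRing)) in Hx. subst x.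
  intros eps.
  set (M := Series (fun n => (INR n + 1) ^ 2 * Rabs (a n))).
  assert (HM : 0 < Rabs M + 1) by (pose proof (Rabs_pos M); lra).
  (* The first bound keeps [w] in the closed disc, where the remainder estimate holds; the second
     makes M |w - z| at most [eps]. [Rabs M + 1] is a positive upper bound of [M]. *)
  assert (Hdelta : 0 < Rmin (1 - Cmod z) (eps / (Rabs M + 1))).
  { apply Rmin_pos; [lra|]. apply Rdiv_lt_0_compat; [apply cond_pos|exact HM]. }
  exists (mkposreal _ Hdelta). intros w Hw.
  change (Cmod (w - z)%C < Rmin (1 - Cmod z) (eps / (Rabs M + 1))) in Hw.
  change (Cmod (cpseries a w - cpseries a z - (w - z) * cpseries (cpseries_deriv a) z)%C
          <= eps * Cmod (w - z)%C).
  assert (Hw1 : Cmod w <= 1).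
  { replace w with ((w - z) + z)%C by ring.
    eapply Rle_trans; [apply Cmod_triangle|].
    pose proof (Rmin_l (1 - Cmod z) (eps / (Rabs M + 1))). lra. }
  eapply Rle_trans; [apply cpseries_taylor_remainder; [exact Ha|exact Hw1|lra]|].
  fold M. pose proof (Cmod_ge_0 (w - z)) as Hd.
  assert (Hwe : Cmod (w - z) * (Rabs M + 1) <= eps).
  { apply Rmult_le_reg_r with (/ (Rabs M + 1)); [now apply Rinv_0_lt_compat|].
    rewrite Rmult_assoc, Rinv_r, Rmult_1_r by lra.
    pose proof (Rmin_r (1 - Cmod z) (eps / (Rabs M + 1))). unfold Rdiv in *. lra. }
  pose proof (Rle_abs M). nra.
Qed.

(** * A sufficient condition for uniform convexity *)

Lemma norm_C_R (z : C) : norm (V := C_R_NormedModule) z = Cmod z.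
Proof.
  change (sqrt (Rabs (fst z) ^ 2 + Rabs (snd z) ^ 2) = Cmod z).
  rewrite !pow2_abs. reflexivity.
Qed.

Lemma is_linear_Cmult_r (l : C) :
  is_linear (K := R_AbsRing) (U := C_R_NormedModule) (V := C_R_NormedModule)
    (fun y : C => (y * l)%C).
Proof.
  split.
  - intros x y. change ((x + y) * l = x * l + y * l)%C. ring.
  - intros k x. apply injective_projections; simpl; unfold scal; simpl; unfold mult; simpl; ring.
  - exists (Cmod l + 1). pose proof (Cmod_ge_0 l). split; [lra|].
    intros x. rewrite !norm_C_R, Cmod_mult. pose proof (Cmod_ge_0 x). nra.
Qed.

(** The two derivatives live over different scalar fields. The complex one is reread as the
    real-linear map y -> y l; [locally_C] and [norm_C_R] match the neighbourhoods and norms of the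
    two structures on C. *)
Lemma is_derive_C_comp (F : C -> C) (gam : R -> C) (t : R) (l dgam : C) :
  is_derive (K := C_AbsRing) (V := C_NormedModule) F (gam t) l ->
  is_derive (K := R_AbsRing) (V := C_R_NormedModule) gam t dgam ->
  is_derive (K := R_AbsRing) (V := C_R_NormedModule) (fun s => F (gam s)) t (dgam * l)%C.
Proof.
  intros [_ HF] Hgam.
  assert (HFR : filterdiff (K := R_AbsRing) (U := C_R_NormedModule) (V := C_R_NormedModule)
            F (locally (gam t)) (fun y : C => (y * l)%C)).
  { split; [apply is_linear_Cmult_r|].
    intros x Hx.
    apply (is_filter_lim_locally_unique (V := C_R_NormedModule)) in Hx. subst x.
    intros eps.
    assert (Hz : is_filter_lim (T := AbsRing_UniformSpace C_AbsRing)
                   (locally (T := AbsRing_UniformSpace C_AbsRing) (gam t)) (gam t))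
      by (intros P HP; exact HP).
    specialize (HF (gam t) Hz eps). apply locally_C in HF.
    revert HF. apply filter_imp. intros y Hy. rewrite !norm_C_R. exact Hy. }
  pose proof (filterdiff_comp' gam F t _ _ Hgam HFR) as Hc.
  apply (filterdiff_ext_lin _ _ _ Hc).
  intros y. apply injective_projections; simpl; unfold scal; simpl; unfold mult; simpl; ring.
Qed.

Lemma is_derive_fst (w : R -> C) (t : R) (l : C) :
  is_derive (K := R_AbsRing) (V := C_R_NormedModule) w t l ->
  is_derive (fun s => fst (w s)) t (fst l).
Proof.
  intros Hw.
  exact (filterdiff_comp' w (fst : C_R_NormedModule -> R_NormedModule) t _ _ Hw
           (filterdiff_linear _ is_linear_fst)).
Qed.

Lemma is_derive_snd (w : R -> C) (t : R) (l : C) :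
  is_derive (K := R_AbsRing) (V := C_R_NormedModule) w t l ->
  is_derive (fun s => snd (w s)) t (snd l).
Proof.
  intros Hw.
  exact (filterdiff_comp' w (snd : C_R_NormedModule -> R_NormedModule) t _ _ Hw
           (filterdiff_linear _ is_linear_snd)).
Qed.

Lemma is_derive_pair (u v : R -> R) (t du dv : R) :
  is_derive u t du -> is_derive v t dv ->
  is_derive (K := R_AbsRing) (V := C_R_NormedModule) (fun s => (u s, v s)) t (du, dv).
Proof.
  intros [_ Hu] [_ Hv]. split.
  { apply (is_linear_scal_l (V := C_R_NormedModule)). }
  intros x Hx.
  apply (is_filter_lim_locally_unique (V := R_NormedModule)) in Hx. subst x.
  assert (Ht : is_filter_lim (locally t) t) by (intros P HP; exact HP).
  intros eps.
  pose proof (filter_and _ _ (Hu t Ht (pos_div_2 eps)) (Hv t Ht (pos_div_2 eps))) as H.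
  revert H. apply filter_imp. intros s [H1 H2]. rewrite norm_C_R.
  change (Rabs (u s - u t - (s - t) * du) <= eps / 2 * Rabs (s - t)) in H1.
  change (Rabs (v s - v t - (s - t) * dv) <= eps / 2 * Rabs (s - t)) in H2.
  change (Cmod (u s - u t - (s - t) * du, v s - v t - (s - t) * dv) <= eps * Rabs (s - t)).
  set (p := u s - u t - (s - t) * du) in *. set (q := v s - v t - (s - t) * dv) in *.
  replace (p, q) with (RtoC p + RtoC q * Ci)%C
    by (apply injective_projections; simpl; ring).
  eapply Rle_trans; [apply Cmod_triangle|].
  rewrite Cmod_mult, Cmod_Ci, !Cmod_R. lra.
Qed.

Lemma Cmod_cos_sin (t : R) : Cmod (cos t, sin t) = 1.
Proof.
  unfold Cmod. simpl fst; simpl snd.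
  pose proof (sin2_cos2 t) as Hsc. rewrite !Rsqr_pow2 in Hsc.
  replace (cos t ^ 2 + sin t ^ 2) with 1 by lra. apply sqrt_1.
Qed.

Lemma circle_param_derive (zeta : C) (r t : R) :
  is_derive (K := R_AbsRing) (V := C_R_NormedModule) (circle_param zeta r) t
    (RtoC r * Ci * (cos t, sin t))%C.
Proof.
  replace (RtoC r * Ci * (cos t, sin t))%C with ((- (r * sin t), r * cos t) : C)
    by (apply injective_projections; simpl; ring).
  apply (is_derive_ext (V := C_R_NormedModule)
    (fun s => (fst zeta + r * cos s, snd zeta + r * sin s))).
  { intros s. apply injective_projections; simpl; ring. }
  apply is_derive_pair; auto_derive; try exact I; ring.
Qed.

Lemma polar_atan (z : C) :
  0 < Re z ->
  z = (RtoC (Cmod z) * (cos (atan (Im z / Re z)), sin (atan (Im z / Re z))))%C.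
Proof.
  destruct z as [u v]. unfold Re, Im, Cmod. simpl fst. simpl snd. intros Hu.
  assert (Hs : sqrt (1 + (v / u)²) = sqrt (u ^ 2 + v ^ 2) / u).
  { replace (1 + (v / u)²) with ((u ^ 2 + v ^ 2) / u ^ 2) by (unfold Rsqr; field; lra).
    assert (0 < u ^ 2) by (apply pow_lt; exact Hu).
    rewrite sqrt_div by nra. rewrite sqrt_pow2 by lra. reflexivity. }
  rewrite cos_atan, sin_atan, Hs.
  assert (0 < sqrt (u ^ 2 + v ^ 2)) by (apply sqrt_lt_R0; nra).
  apply injective_projections; unfold Cmult, RtoC; cbn [fst snd]; field; lra.
Qed.

(** The value is Im (d / w), the imaginary part of the logarithmic derivative, with the quotient
    cleared by the conjugate. *)
Lemma is_derive_atan_arg (w : R -> C) (t : R) (d : C) :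
  is_derive (K := R_AbsRing) (V := C_R_NormedModule) w t d -> 0 < Re (w t) ->
  is_derive (fun s => atan (Im (w s) / Re (w s))) t
    (Im (d * Cconj (w t))%C / Cmod (w t) ^ 2).
Proof.
  intros Hd Hre. rewrite Cmod2_alt.
  pose proof (is_derive_fst _ _ _ Hd) as Hu. pose proof (is_derive_snd _ _ _ Hd) as Hv.
  change (is_derive (fun s => Re (w s)) t (Re d)) in Hu.
  change (is_derive (fun s => Im (w s)) t (Im d)) in Hv.
  assert (Hne : Re (w t) <> 0) by lra.
  pose proof (is_derive_div _ _ t _ _ Hv Hu Hne) as Hq.
  pose proof (is_derive_comp atan _ t _ _ (is_derive_atan _) Hq) as Hc.
  revert Hc. unfold scal; simpl; unfold mult; simpl.
  replace (Im d * - snd (w t) + 0)%R with (Im d * - snd (w t))%R by ring.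
  match goal with |- is_derive _ _ ?x -> is_derive _ _ ?y => replace y with x; [tauto|] end.
  unfold Rsqr, Re, Im in *. field. split; nra.
Qed.

(** [g] and [h] stand for F' and F''; the last hypothesis bounds the pre-Schwarzian F''/F' by
    1/2. *)
Lemma UCV_of_pre_schwarzian (F g h : C -> C) :
  F (RtoC 0) = RtoC 0 -> g (RtoC 0) = RtoC 1 ->
  (forall z, unit_disc z -> is_derive (K := C_AbsRing) (V := C_NormedModule) F z (g z)) ->
  (forall z, unit_disc z -> is_derive (K := C_AbsRing) (V := C_NormedModule) g z (h z)) ->
  (forall z, unit_disc z -> 0 < Re (g z)) ->
  (forall z, unit_disc z -> 2 * Cmod (h z) <= Cmod (g z)) ->
  UCV F.
Proof.
  intros HF0 Hg0 HF Hg Hre Hh.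
  assert (H0 : unit_disc (RtoC 0)) by (unfold unit_disc; rewrite Cmod_0; lra).
  split; [|split; [|split]].
  { intros z Hz. exists (g z). now apply HF. }
  { exact HF0. }
  { rewrite <- Hg0. apply is_C_derive_unique, HF, H0. }
  intros zeta r t1 t2 Hzeta Hr _ _ Hdisc.
  set (gam := circle_param zeta r) in *.
  set (arg := fun t => atan (Im (g (gam t)) / Re (g (gam t)))).
  assert (Hgpos : forall t, t1 <= t <= t2 -> 0 < Cmod (g (gam t))).
  { intros t Ht. specialize (Hre _ (Hdisc t Ht)).
    pose proof (re_le_Cmod (g (gam t))). pose proof (Rle_abs (Re (g (gam t)))). lra. }
  (* The center and the point at [t] both lie in the disc, so their distance is below the diameter
     2. The full circle may well leave the disc. *)
  assert (Hr2 : forall t, t1 <= t <= t2 -> r < 2).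
  { intros t Ht. specialize (Hdisc t Ht). unfold unit_disc in *.
    assert (Heq : Cmod (gam t + - zeta)%C = r).
    { unfold gam, circle_param.
      replace (zeta + RtoC r * (cos t, sin t) + - zeta)%C
        with (RtoC r * (cos t, sin t))%C by ring.
      rewrite Cmod_mult, Cmod_R, Cmod_cos_sin, Rabs_pos_eq by lra. ring. }
    pose proof (Cmod_triangle (gam t) (- zeta)%C) as Htri.
    rewrite Cmod_opp in Htri. lra. }
  assert (Harg : forall t, t1 <= t <= t2 -> exists d, -1 <= d /\ is_derive arg t d).
  { intros t Ht.
    specialize (Hdisc t Ht). specialize (Hr2 t Ht). specialize (Hgpos t Ht).
    pose proof (is_derive_C_comp g gam t _ _ (Hg _ Hdisc) (circle_param_derive zeta r t)) as Hd.
    specialize (Hre _ Hdisc). specialize (Hh _ Hdisc).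
    eexists; split; [|exact (is_derive_atan_arg _ _ _ Hd Hre)].
    match goal with |- _ <= Im ?x / _ => set (y := x) end.
    assert (Hy : Cmod y <= Cmod (g (gam t)) ^ 2).
    { unfold y. rewrite !Cmod_mult, Cmod_conj, Cmod_Ci, Cmod_cos_sin, Cmod_R, Rabs_pos_eq by lra.
      pose proof (Cmod_ge_0 (h (gam t))).
      assert (r * Cmod (h (gam t)) <= Cmod (g (gam t))) by nra. nra. }
    assert (Him : Rabs (Im y) <= Cmod y).
    { eapply Rle_trans; [apply Rmax_r|apply Rmax_Cmod]. }
    apply Rmult_le_reg_r with (Cmod (g (gam t)) ^ 2); [now apply pow_lt|].
    unfold Rdiv. rewrite Rmult_assoc, Rinv_l by (apply pow_nonzero; lra).
    pose proof (Rle_abs (- Im y)) as Hle. rewrite Rabs_Ropp in Hle. lra. }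
  set (theta := fun t => t + PI / 2 + arg t).
  assert (Htheta : forall t, t1 <= t <= t2 -> exists d, 0 <= d /\ is_derive theta t d).
  { intros t Ht. destruct (Harg t Ht) as [d [Hd Hder]].
    exists (1 + d). split; [lra|].
    apply (is_derive_plus (V := R_NormedModule) (fun t => t + PI / 2) arg); [|exact Hder].
    auto_derive; [exact I|ring]. }
  exists (fun t => (RtoC r * Ci * (cos t, sin t) * g (gam t))%C), theta.
  split.
  - intros t Ht. pose proof (Hdisc t Ht) as Hz. specialize (Hgpos t Ht).
    set (w' := (RtoC r * Ci * (cos t, sin t) * g (gam t))%C).
    assert (Hmod : Cmod w' = r * Cmod (g (gam t))).
    { unfold w'. rewrite !Cmod_mult, Cmod_Ci, Cmod_cos_sin, Cmod_R, Rabs_pos_eq by lra. ring. }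
    split; [|split; [|split]].
    + exact (is_derive_C_comp F gam t _ _ (HF _ Hz) (circle_param_derive zeta r t)).
    + apply Cmod_gt_0. rewrite Hmod. now apply Rmult_lt_0_compat.
    + rewrite Hmod. unfold w'. rewrite (polar_atan (g (gam t)) (Hre _ Hz)) at 1.
      fold (arg t). unfold theta.
      replace (t + PI / 2 + arg t) with (PI / 2 + (t + arg t)) by ring.
      rewrite <- cos_sin. replace (cos (PI / 2 + (t + arg t))) with (- sin (t + arg t))
        by (rewrite sin_cos; ring).
      rewrite sin_plus, cos_plus.
      apply injective_projections; simpl; ring.
    + destruct (Htheta t Ht) as [d [_ Hd]].
      apply (ex_derive_continuous theta). now exists d.
  - intros s t Hs Hst Ht.
    apply is_derive_nondecreasing with (Derive theta); [exact Hst| |];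
      intros x Hx; destruct (Htheta x ltac:(lra)) as [d [Hd Hder]];
      rewrite (is_derive_unique _ _ _ Hder); assumption.
Qed.

(** * The Wright function *)

(** Uniqueness of the sum stands in for extensionality of coefficient sequences. *)
Lemma cpseries_ext (a a' : nat -> R) (z : C) :
  ex_series (fun n => Rabs (a n)) -> Cmod z <= 1 -> (forall n, a n = a' n) ->
  cpseries a' z = cpseries a z.
Proof.
  intros Ha Hz Heq. apply iota_is_series_C.
  apply (is_series_ext (V := C_NormedModule) (cterm a z)).
  - intros n. unfold cterm. now rewrite Heq.
  - now apply cpseries_correct.
Qed.

Lemma cpseries_0 (a : nat -> R) :
  ex_series (fun n => Rabs (a n)) -> cpseries a (RtoC 0) = RtoC (a 0%nat).
Proof.
  intros Ha. apply iota_is_series_C.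
  apply (is_series_decr_1 (V := C_NormedModule)).
  apply (is_series_ext (V := C_NormedModule) (fun _ => RtoC 0)).
  { intros n. change (@eq C (RtoC 0) (RtoC (a (S n)) * RtoC 0 ^ S n)%C). rewrite Cpow_S. ring. }
  match goal with |- is_series _ ?s => assert (H0 : s = RtoC 0) end.
  { change (@eq C (RtoC (a 0%nat) - cterm a (RtoC 0) 0)%C (RtoC 0)). unfold cterm. simpl. ring. }
  rewrite H0.
  apply (filterlim_ext (fun _ => RtoC 0)).
  - induction x as [|n IH]; [now rewrite sum_O|].
    rewrite sum_Sn, <- IH. change (@eq C (RtoC 0) (RtoC 0 + RtoC 0)%C). ring.
  - apply filterlim_const.
Qed.

(** Over k >= 1 put S1 = sum c_k and S2 = sum k c_k, so the last hypothesis is 2 S2 + S1 <= 1. As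
    |F' - 1| <= S1 and |F''| <= S2, 2|F''| <= 1 - S1 <= |F'|. Moreover S1 <= S2 forces S1 <= 1/3,
    hence Re F' > 0. *)
Lemma UCV_of_coefficient_bound (c : nat -> R) :
  (forall k, 0 <= c k) -> c 0%nat = 1 ->
  ex_series (fun k => (INR k + 1) ^ 2 * c k) ->
  Series (fun k => (2 * INR (S k) + 1) * c (S k)) <= 1 ->
  exists F : C -> C, UCV F /\ forall z, unit_disc z -> C_derive F z = cpseries c z.
Proof.
  intros Hc Hc0 Hex Hsum.
  assert (Hexa : ex_series (fun k => (INR k + 1) ^ 2 * Rabs (c k))).
  { apply (ex_series_ext (V := R_NormedModule)) with (2 := Hex).
    intros k. rewrite Rabs_pos_eq by apply Hc. reflexivity. }
  pose proof (ex_series_abs_weight c Hexa) as Habs.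
  pose proof (ex_series_cpseries_deriv c Hexa) as Hdabs.
  (* Coefficients of the primitive; the leading 0 normalizes F(0) = 0. *)
  set (b := fun n => match n with O => 0 | S k => c k / INR (S k) end).
  assert (Hdb : forall k, c k = cpseries_deriv b k).
  { intros k. unfold cpseries_deriv, b. field. apply not_0_INR. lia. }
  assert (Hexb : ex_series (fun k => (INR k + 1) ^ 2 * Rabs (b k))).
  { apply (ex_series_incr_1 (V := R_NormedModule)).
    (* The index shift changes the weight (k+1)^2 into (k+2)^2 <= 4(k+1)^2, whence the 4. *)
    apply (ex_series_le (V := R_CompleteNormedModule))
      with (b := fun k => 4 * ((INR k + 1) ^ 2 * c k)).
    2: exact (ex_series_scal (V := R_NormedModule) 4 _ Hex).
    intros k. change (Rabs ((INR (S k) + 1) ^ 2 * Rabs (b (S k)))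
                      <= 4 * ((INR k + 1) ^ 2 * c k)).
    pose proof (pos_INR k) as Hk. pose proof (Hc k) as Hck.
    unfold b. rewrite S_INR.
    assert (Hq : 0 <= c k / (INR k + 1) <= c k).
    { split; [apply Rdiv_le_0_compat; lra|].
      apply Rmult_le_reg_r with (INR k + 1); [lra|].
      unfold Rdiv. rewrite Rmult_assoc, Rinv_l by lra. nra. }
    rewrite (Rabs_pos_eq (c k / (INR k + 1))) by lra.
    rewrite Rabs_pos_eq by (apply Rmult_le_pos; [apply pow2_ge_0|lra]).
    apply Rle_trans with ((INR k + 1 + 1) ^ 2 * c k).
    - apply Rmult_le_compat_l; [apply pow2_ge_0|lra].
    - rewrite <- Rmult_assoc. apply Rmult_le_compat_r; nra. }
  assert (HF : forall z, unit_disc z ->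
            is_derive (K := C_AbsRing) (V := C_NormedModule) (cpseries b) z (cpseries c z)).
  { intros z Hz. unfold unit_disc in Hz.
    rewrite <- (cpseries_ext c (cpseries_deriv b) z Habs ltac:(lra) Hdb).
    now apply cpseries_derive. }
  assert (Hex1 : ex_series (fun k => c (S k))).
  { apply (proj1 (ex_series_incr_1 (V := R_NormedModule) c)).
    now apply ex_series_Rabs. }
  assert (Hex2 : ex_series (cpseries_deriv c)) by now apply ex_series_Rabs.
  set (S1 := Series (fun k => c (S k))). set (S2 := Series (cpseries_deriv c)).
  assert (HS : 2 * S2 + S1 <= 1).
  { unfold S1, S2. rewrite <- Series_scal_l, <- Series_plus; [| |exact Hex1].
    2: now apply (ex_series_scal_l (V := R_NormedModule) 2).
    eapply Rle_trans; [|exact Hsum]. apply Req_le, Series_ext.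
    intros k. unfold cpseries_deriv. ring. }
  assert (HS12 : S1 <= S2).
  { apply Series_le; [|exact Hex2]. intros k. split; [apply Hc|].
    unfold cpseries_deriv. rewrite S_INR. pose proof (pos_INR k). pose proof (Hc (S k)). nra. }
  assert (Hg1 : forall z, unit_disc z -> Cmod (cpseries c z - RtoC 1)%C <= S1).
  { intros z Hz. unfold unit_disc in Hz.
    apply (is_series_Cmod_le (fun k => cterm c z (S k))); [| |exact Hex1].
    - apply (is_series_incr_1 (V := C_NormedModule)).
      match goal with |- is_series _ ?s => assert (H0 : s = cpseries c z) end.
      { change (@eq C (cpseries c z - RtoC 1 + cterm c z 0)%C (cpseries c z)).
        unfold cterm. rewrite Hc0. simpl. ring. }
      rewrite H0. apply cpseries_correct; [exact Habs|lra].
    - intros k. eapply Rle_trans; [apply Cmod_cterm_le; lra|].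
      rewrite Rabs_pos_eq by apply Hc. lra. }
  assert (Hh : forall z, unit_disc z -> Cmod (cpseries (cpseries_deriv c) z) <= S2).
  { intros z Hz. unfold unit_disc in Hz.
    apply (is_series_Cmod_le (cterm (cpseries_deriv c) z)); [| |exact Hex2].
    - apply cpseries_correct; [exact Hdabs|lra].
    - intros k. eapply Rle_trans; [apply Cmod_cterm_le; lra|].
      unfold cpseries_deriv. rewrite Rabs_pos_eq; [lra|].
      apply Rmult_le_pos; [apply pos_INR|apply Hc]. }
  exists (cpseries b). split.
  - apply UCV_of_pre_schwarzian with (cpseries c) (cpseries (cpseries_deriv c)).
    + rewrite cpseries_0; [reflexivity|]. now apply ex_series_abs_weight.
    + rewrite cpseries_0 by exact Habs. now rewrite Hc0.
    + exact HF.
    + intros z Hz. now apply cpseries_derive.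
    + intros z Hz. pose proof (re_le_Cmod (cpseries c z - RtoC 1)%C) as Hre.
      specialize (Hg1 z Hz).
      assert (Habs1 : Rabs (Re (cpseries c z - RtoC 1)%C) < 1) by lra.
      apply Rabs_def2 in Habs1.
      change (Re (cpseries c z - RtoC 1)%C) with (Re (cpseries c z) + - (1)) in Habs1. lra.
    + intros z Hz. specialize (Hg1 z Hz). specialize (Hh z Hz).
      pose proof (Cmod_triangle (cpseries c z) (- (cpseries c z - RtoC 1))%C) as Htri.
      rewrite Cmod_opp in Htri.
      replace (cpseries c z + - (cpseries c z - RtoC 1))%C with (RtoC 1) in Htri by ring.
      rewrite Cmod_1 in Htri. lra.
  - intros z Hz. now apply is_C_derive_unique, HF.
Qed.

Lemma ex_series_nonneg_bounded (u : nat -> R) (M : R) :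
  (forall n, 0 <= u n) -> (forall n, sum_n u n <= M) -> ex_series u.
Proof.
  intros Hu HM.
  destruct (ex_finite_lim_seq_incr (sum_n u) M) as [l Hl].
  - intros n. rewrite sum_Sn. specialize (Hu (S n)). unfold plus; simpl. lra.
  - exact HM.
  - exists l. exact Hl.
Qed.

Lemma wright_coef_summable (a b mu nu : R) :
  1 <= a -> 1 <= b -> 1 <= mu -> 1 <= nu -> tau a <= b ->
  ex_series (fun k => (INR k + 1) ^ 2 * wright_coef mu a nu b k) /\
  Series (fun k => (2 * INR (S k) + 1) * wright_coef mu a nu b (S k)) <= 1.
Proof.
  intros Ha Hb Hmu Hnu Htau.
  set (e := wright_coef 1 a 1 b). set (c := wright_coef mu a nu b).
  assert (He : forall k, 0 < e k) by (intros k; apply wright_coef_bounds; lra).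
  assert (Hce : forall k, 0 < c k <= e k) by (intros k; now apply wright_coef_bounds).
  set (t := fun k => (2 * INR (S k) + 1) * e (S k)).
  assert (Ht : forall k, 0 <= t k).
  { intros k. apply Rmult_le_pos; [pose proof (pos_INR (S k)); lra|apply Rlt_le, He]. }
  assert (Hbound : forall N, sum_n t N <= 1) by (intros N; now apply wright_coef_sum_bound).
  pose proof (ex_series_nonneg_bounded t 1 Ht Hbound) as Hext.
  assert (Hle : forall k, 0 <= (2 * INR (S k) + 1) * c (S k) <= t k).
  { intros k. pose proof (pos_INR (S k)). specialize (Hce (S k)). unfold t. split; nra. }
  split.
  (* The coefficient sum controls only a linear weight. The quadratic one comes from e(k+1) =
     e(k)/((a+k)(b+k)) <= e(k)/(k+1)^2: the weighted term of index k + 1 is at most 4 e(k), and [e]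
     is summable. *)
  - assert (Hexe : ex_series e).
    { apply (ex_series_incr_1 (V := R_NormedModule)).
      apply (ex_series_le (V := R_CompleteNormedModule)) with (2 := Hext).
      intros k. change (Rabs (e (S k)) <= t k). unfold t.
      pose proof (He (S k)). pose proof (pos_INR (S k)). rewrite Rabs_pos_eq by lra. nra. }
    apply (ex_series_incr_1 (V := R_NormedModule)).
    apply (ex_series_le (V := R_CompleteNormedModule)) with (b := fun k => 4 * e k).
    2: exact (ex_series_scal (V := R_NormedModule) 4 _ Hexe).
    intros k. change (Rabs ((INR (S k) + 1) ^ 2 * c (S k)) <= 4 * e k).
    pose proof (Hce (S k)) as Hck. pose proof (pos_INR k) as Hk.
    assert (Hrec : (a + INR k) * (b + INR k) * e (S k) = e k).
    { unfold e. rewrite wright_coef_succ by assumption. field. lra. }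
    rewrite S_INR.
    rewrite Rabs_pos_eq by (apply Rmult_le_pos; [apply pow2_ge_0|lra]).
    apply Rle_trans with ((INR k + 1 + 1) ^ 2 * e (S k)).
    { apply Rmult_le_compat_l; [apply pow2_ge_0|lra]. }
    rewrite <- Hrec, <- Rmult_assoc. apply Rmult_le_compat_r; [apply Rlt_le, He|].
    assert ((INR k + 1) * (INR k + 1) <= (a + INR k) * (b + INR k)).
    { apply Rmult_le_compat; lra. }
    nra.
  - eapply Rle_trans; [apply (Series_le _ t Hle Hext)|].
    pose proof (Series_correct t Hext) as Hs.
    apply (is_lim_seq_le (sum_n t) (fun _ => 1) (Finite (Series t)) (Finite 1) Hbound Hs).
    apply is_lim_seq_const.
Qed.

Theorem theorem4p3 (a b mu nu : R)
  (ha : 1 <= a) (hb : 1 <= b) (hmu : 1 <= mu) (hnu : 1 <= nu)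
  (hab : tau a <= b) :
  class_Sp (wright mu a nu b).
Proof.
  set (c := wright_coef mu a nu b).
  destruct (wright_coef_summable a b mu nu ha hb hmu hnu hab) as [Hex Hsum].
  assert (Hc : forall k, 0 <= c k).
  { intros k. apply Rlt_le. now apply wright_coef_bounds. }
  destruct (UCV_of_coefficient_bound c Hc) as [F [HF HdF]].
  { now apply wright_coef_0. }
  { exact Hex. }
  { exact Hsum. }
  exists F. split; [exact HF|].
  intros z Hz. rewrite (HdF z Hz). unfold unit_disc in Hz.
  (* It is enough to exhibit z F'(z) as a sum of the defining series of [wright]. *)
  apply iota_is_series_C.
  apply (is_series_ext (V := C_NormedModule) (fun k => scal z (cterm c z k))).
  { intros k. change (@eq C (z * (RtoC (c k) * z ^ k))%C (RtoC (c k) * z ^ (k + 1))%C).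
    rewrite Nat.add_1_r, Cpow_S. ring. }
  apply (is_series_scal (V := C_NormedModule)).
  apply cpseries_correct; [|lra].
  apply ex_series_abs_weight.
  apply (ex_series_ext (V := R_NormedModule)) with (2 := Hex).
  intros k. fold c. rewrite Rabs_pos_eq by apply Hc. reflexivity.
Qed.
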